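(* (In $\mathbf{ZF}+\mathbf{HB}+\mathbf{DC}$.) Every sup-reflexive normed space is J-reflexive.
   Context: Normed spaces are real and not assumed complete. The base theory is Zermelo–Fraenkel set theory $\mathbf{ZF}$ without choice. $\mathbf{HB}$ is the Hahn–Banach axiom: given a real vector space $E$, a sublinear $p:E\to\mathbb R$, a vector subspace $F$ of $E$ and a linear $f:F\to\mathbb R$ with $f\le p$ on $F$, there is a linear $\tilde f:E\to\mathbb R$ extending $f$ with $\tilde f\le p$. $\mathbf{DC}$ is the axiom of Dependent Choices: if $X$ is a non-empty set and $R\subseteq X\times X$ satisfies $\forall x\in X\ \exists y\in X\ xRy$, then there is a sequence $(x_n)_{n\in\mathbb N}$ of $X$ with $x_nRx_{n+1}$ for all $n$. For a normed space $E$, $\Gamma_E$ is its closed unit ball and $E'$ is its continuous dual. $E$ is sup-reflexive if every $f\in E'$ attains its supremum on $\Gamma_E$. $E$ is J-reflexive if $\Gamma_E$ contains no sequence $(a_n)_{n\in\mathbb N}$ such that $$\inf_{n\in\mathbb N} d\big(\mathrm{span}\{a_i: i<n\},\ \mathrm{conv}\{a_i: i\ge n\}\big)>0,$$ where $d(A,B)=\inf\{\|a-b\|: a\in A, b\in B\}$. *)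

(* Defs.v *)
From Stdlib Require Import Reals.
From Coquelicot Require Import Coquelicot.

Open Scope R_scope.

(** Vector spaces and normed spaces are Coquelicot's [ModuleSpace R_Ring] and
    [NormedModule R_AbsRing]. Unlike MathComp structures these carry no choice
    operator, so that the only choice principles in sight are the explicit
    hypotheses [HB] and [DC]. *)

Section VectorSpaces.

Context {E : ModuleSpace R_Ring}.

Definition subspace (F : E -> Prop) : Prop :=
  F zero
  /\ (forall x y : E, F x -> F y -> F (plus x y))
  /\ (forall (t : R) (x : E), F x -> F (scal t x)).

Definition convex (C : E -> Prop) : Prop :=
  forall (x y : E) (t : R), C x -> C y -> 0 <= t <= 1 ->
    C (plus (scal t x) (scal (1 - t) y)).

Definition span (A : E -> Prop) (x : E) : Prop :=
  forall F : E -> Prop, subspace F -> (forall y, A y -> F y) -> F x.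

Definition conv (A : E -> Prop) (x : E) : Prop :=
  forall C : E -> Prop, convex C -> (forall y, A y -> C y) -> C x.

Definition linear_on (F : E -> Prop) (f : E -> R) : Prop :=
  (forall x y : E, F x -> F y -> f (plus x y) = f x + f y)
  /\ (forall (t : R) (x : E), F x -> f (scal t x) = t * f x).

Definition linear (f : E -> R) : Prop := linear_on (fun _ => True) f.

Definition sublinear (p : E -> R) : Prop :=
  (forall x y : E, p (plus x y) <= p x + p y)
  /\ (forall (t : R) (x : E), 0 <= t -> p (scal t x) = t * p x).

End VectorSpaces.

(** A functional on the subspace [F] is represented by a function on [E] of
    which only the values on [F] matter. *)
Definition HB : Prop :=
  forall (E : ModuleSpace R_Ring) (p : E -> R) (F : E -> Prop) (f : E -> R),
    sublinear p -> subspace F -> linear_on F f ->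
    (forall x, F x -> f x <= p x) ->
    exists g : E -> R,
      linear g /\ (forall x, F x -> g x = f x) /\ (forall x, g x <= p x).

Definition DC : Prop :=
  forall (X : Type) (S : X -> X -> Prop),
    (exists x : X, True) -> (forall x, exists y, S x y) ->
    exists u : nat -> X, forall n : nat, S (u n) (u (Datatypes.S n)).

Section NormedSpaces.

Context {E : NormedModule R_AbsRing}.

Definition unit_ball (x : E) : Prop := norm x <= 1.

Definition in_dual (f : E -> R) : Prop :=
  linear f /\ forall x : E, continuous f x.

Definition set_dist (A B : E -> Prop) : Rbar :=
  Glb_Rbar (fun r => exists a b : E, A a /\ B b /\ r = norm (minus a b)).

End NormedSpaces.

Definition sup_reflexive (E : NormedModule R_AbsRing) : Prop :=
  forall f : E -> R, in_dual f ->
    exists x : E, unit_ball x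
      /\ is_lub (fun r => exists y : E, unit_ball y /\ r = f y) (f x).

Definition J_reflexive (E : NormedModule R_AbsRing) : Prop :=
  ~ exists a : nat -> E,
      (forall n, unit_ball (a n))
      /\ Rbar_lt 0
           (Inf_seq (fun n : nat =>
              set_dist (span (fun x => exists i, (i < n)%nat /\ x = a i))
                       (conv (fun x => exists i, (n <= i)%nat /\ x = a i)))).

(* Main.v *)
Require Import Defs.
From Stdlib Require Import Reals Lra Lia Classical.
From Coquelicot Require Import Coquelicot.
Import Defs.

(** The argument is that of James, in the style of Pryce and Simons.

    Suppose that the unit ball contains a sequence [a] all of whose distances
    d(span{a_i : i<n}, conv{a_i : i>=n}) are at least [theta > 0]. Separating
    the two sets by Hahn-Banach gives functionals f_n in the dual ball which
    vanish on a_i for i<n and are at least [theta] on a_i for i>=n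
    ([james_functionals]). Let w be a cluster functional of (f_n): a linear
    functional with liminf f_n <= w <= limsup f_n pointwise, which exists by
    Hahn-Banach ([cluster_exists]). Then w(a_i) = 0 for every i, while a convex
    combination g of the f_n is at least [theta] at a_i for all large i; hence
    sup (g - w) >= theta on the unit ball ([james_separation]). This gap alone
    produces a continuous functional without a maximum on the ball
    ([not_attaining]).

    That functional is v = h - w with h = sum_n beta_n g_n, where g_n is a
    convex combination of the f_k with k>=n, beta_n = r^n (1 - r), and the
    remaining mass after n terms is r^n. Put s_n = sum_(k<n) beta_k g_k. Each
    g_n is chosen to make sup (s_n + r^n g_n - w) nearly as small as possible;
    these near-infima a_n increase, and are at least [theta]. Assume that v has
    a maximum at y, with value A. Then a_n <= A, and by near-optimality
    (s_n + r^n g_n - w)(y) is at most A plus a tiny error. As s_(n+1) is a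
    combination of s_n and s_n + r^n g_n with weights r and 1 - r, induction
    yields s_n(y) - (1 - r^n) w(y) <= (1 - r^n) A + r^n theta/2. So the terms
    from n on contribute at least r^n (A - theta/2) to v(y) = A. Because r is
    small, the n-th term carries almost all of that weight, and (g_n - w)(y)
    stays above theta/8 for every n. This contradicts that w is a cluster
    functional of (g_n).

    There is a circularity: w must be a cluster functional of (g_n), but the
    choice of g_n refers to w. It is broken by minimizing over the sequence as
    well: stage n works with a sequence F_n of convex blocks of F_(n-1), and
    minimizes the supremum over the ball and over all cluster functionals of a
    further block sequence. Passing to a subsequence whose values at a nearly
    extremal point are controlled ([block_pinning]) then makes the
    supremum nearly the same for every remaining cluster functional, so that
    any w which is a cluster functional of the diagonal (g_n) can be used
    ([optimal_block], [near_optimal_blocks]). *)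

(** * Dependent choice from a given starting point *)

(** [DC] does not let one prescribe the first term. Applying it to finite
    chains issued from [a], ordered by one-step extension, does: the chains
    obtained agree with one another and their diagonal is the sequence. *)
Lemma DC_from (hDC : DC) (A : Type) (P : A -> Prop) (T : A -> A -> Prop) (a : A) :
  P a -> (forall x, P x -> exists y, P y /\ T x y) ->
  exists u : nat -> A, u O = a /\ forall n, P (u n) /\ T (u n) (u (S n)).
Proof.
  intros Pa HT.
  set (good := fun p : nat * (nat -> A) =>
    snd p O = a /\ (forall i, (i <= fst p)%nat -> P (snd p i)) /\
    forall i, (i < fst p)%nat -> T (snd p i) (snd p (S i))).
  set (extends := fun p q : {p | good p} =>
    fst (proj1_sig q) = S (fst (proj1_sig p)) /\
    forall i, (i <= fst (proj1_sig p))%nat ->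
      snd (proj1_sig q) i = snd (proj1_sig p) i).
  assert (Hne : exists p : {p | good p}, True).
  { assert (G : good (O, fun _ => a)).
    { split; [|split]; simpl; auto; intros i Hi; lia. }
    exists (exist _ _ G); exact I. }
  assert (Hext : forall p, exists q, extends p q).
  { intros [[k b] [Hb0 [HbP HbT]]]; simpl in *.
    destruct (HT (b k) (HbP k (le_n k))) as [y [Py Ty]].
    set (b' := fun i => if (i <=? k)%nat then b i else y).
    assert (Hlow : forall i, (i <= k)%nat -> b' i = b i).
    { intros i Hi; unfold b'; now rewrite (proj2 (Nat.leb_le i k) Hi). }
    assert (Htop : b' (S k) = y).
    { unfold b'; now rewrite (proj2 (Nat.leb_gt (S k) k)) by lia. }
    assert (G : good (S k, b')).
    { split; [|split]; simpl.
      - rewrite Hlow by lia; exact Hb0.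
      - intros i Hi; destruct (Nat.eq_dec i (S k)) as [->|Hne'].
        + now rewrite Htop.
        + rewrite Hlow by lia; apply HbP; lia.
      - intros i Hi; destruct (Nat.eq_dec i k) as [->|Hne'].
        + now rewrite Htop, Hlow by lia.
        + rewrite !Hlow by lia; apply HbT; lia. }
    exists (exist _ _ G); split; simpl; auto. }
  destruct (hDC _ extends Hne Hext) as [u Hu].
  set (len := fun n => fst (proj1_sig (u n))).
  set (path := fun n => snd (proj1_sig (u n))).
  assert (Hlen : forall n, (n <= len n)%nat).
  { induction n as [|n IH]; [lia|].
    unfold len in *; rewrite (proj1 (Hu n)); lia. }
  exists (fun n => path n n); split.
  - apply (proj2_sig (u O)).
  - intro n.
    assert (Hgood := proj2_sig (u (S n))).
    destruct Hgood as [_ [HP HR]].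
    assert (E : path n n = path (S n) n).
    { symmetry; apply (proj2 (Hu n)), Hlen. }
    assert (Hl := Hlen (S n)); unfold len in Hl.
    rewrite E; split; [apply HP | apply HR]; lia.
Qed.

Lemma countable_choice (hDC : DC) (A : Type) (Q : nat -> A -> Prop) :
  (forall n, exists x, Q n x) -> exists u : nat -> A, forall n, Q n (u n).
Proof.
  intro H.
  destruct (H O) as [x0 Hx0].
  destruct (DC_from hDC (nat * A) (fun p => Q (fst p) (snd p))
              (fun p q => fst q = S (fst p)) (O, x0) Hx0) as [u [Hu0 Hu]].
  { intros [n x] _; destruct (H (S n)) as [y Hy].
    exists (S n, y); split; [exact Hy | reflexivity]. }
  assert (Hfst : forall n, fst (u n) = n).
  { induction n as [|n IH]; [now rewrite Hu0|].
    now rewrite (proj2 (Hu n)), IH. }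
  exists (fun n => snd (u n)); intro n.
  rewrite <- (Hfst n) at 1; apply Hu.
Qed.

(** * Hahn-Banach for convex cones and separation *)

Lemma Glb_Rbar_finite (A : R -> Prop) (b : R) :
  (exists c, A c) -> (forall c, A c -> b <= c) ->
  (forall c, A c -> real (Glb_Rbar A) <= c) /\
  forall b', (forall c, A c -> b' <= c) -> b' <= real (Glb_Rbar A).
Proof.
  intros [c0 Hc0] Hb.
  destruct (Glb_Rbar_correct A) as [Hlb Hgr].
  assert (H0 := Hlb c0 Hc0).
  assert (H1 := Hgr (Finite b) Hb).
  destruct (Glb_Rbar A) as [a| |]; simpl in *; try contradiction.
  split; [exact Hlb|].
  intros b' Hb'; exact (Hgr (Finite b') Hb').
Qed.

(* The identities below are those of the general hierarchy, stated at the
   structures through which [sublinear] and [linear] see the vector space, as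
   rewriting does not see through the different projections. *)

Lemma scal_R0 {V : ModuleSpace R_Ring} (x : V) : scal 0 x = zero.
Proof. exact (scal_zero_l x). Qed.

Lemma scal_R1 {V : ModuleSpace R_Ring} (x : V) : scal 1 x = x.
Proof. exact (scal_one x). Qed.

Lemma scal_inv {V : ModuleSpace R_Ring} (t : R) (x : V) :
  t <> 0 -> scal (/ t) (scal t x) = x.
Proof.
  intro Ht; rewrite scal_assoc.
  change (mult (/ t) t) with (/ t * t).
  rewrite Rinv_l by exact Ht; apply scal_R1.
Qed.

(** The inequality at [/ t] and [scal t x] is the converse one at [t]. *)
Lemma homogeneous_of_le {V : ModuleSpace R_Ring} (p : V -> R) :
  (forall t x, 0 < t -> p (scal t x) <= t * p x) ->
  forall t x, 0 < t -> p (scal t x) = t * p x.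
Proof.
  intros Hle t x Ht; apply Rle_antisym; [auto|].
  assert (H := Hle (/ t) (scal t x) (Rinv_0_lt_compat t Ht)).
  rewrite scal_inv in H by lra.
  apply Rmult_le_compat_l with (r := t) in H; [|lra].
  now replace (t * (/ t * p (scal t x))) with (p (scal t x)) in H by (field; lra).
Qed.

Lemma vplus_opp_r {V : ModuleSpace R_Ring} (x : V) : plus x (opp x) = zero.
Proof. exact (plus_opp_r x). Qed.

Lemma vplus_opp_l {V : ModuleSpace R_Ring} (x : V) : plus (opp x : V) x = zero.
Proof. exact (plus_opp_l x). Qed.

(** Here [U] is a convex cone of V x R, and [g] is a functional whose graph lies
    below it. The fibrewise infimum of [U] is sublinear, and Hahn-Banach applies
    to it and the zero subspace. Giving [U] instead of a sublinear function makes
    limits superior and distances available without computing with infima. *)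
Lemma hahn_banach_cone (hHB : HB) (V : ModuleSpace R_Ring) (U : V -> R -> Prop) :
  (forall x y c d, U x c -> U y d -> U (plus x y) (c + d)) ->
  (forall t x c, 0 < t -> U x c -> U (scal t x) (t * c)) ->
  (forall x, exists c, U x c) ->
  (forall x, exists b, forall c, U x c -> b <= c) ->
  exists g : V -> R, linear g /\ forall x c, U x c -> g x <= c.
Proof.
  intros Hadd Hscal Htot Hbd.
  set (p := fun x => real (Glb_Rbar (U x))).
  assert (Hp : forall x, (forall c, U x c -> p x <= c) /\
    forall b, (forall c, U x c -> b <= c) -> b <= p x).
  { intro x; destruct (Hbd x) as [b Hb]; now apply Glb_Rbar_finite with b. }
  clearbody p.
  assert (Hle : forall t x, 0 < t -> p (scal t x) <= t * p x).
  { intros t x Ht.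
    assert (H : p (scal t x) / t <= p x).
    { apply (Hp x); intros c Hc.
      apply Rmult_le_reg_l with t; [exact Ht|].
      replace (t * (p (scal t x) / t)) with (p (scal t x)) by (field; lra).
      apply (Hp (scal t x)); auto. }
    apply Rmult_le_compat_l with (r := t) in H; [|lra].
    replace (t * (p (scal t x) / t)) with (p (scal t x)) in H by (field; lra).
    exact H. }
  assert (Hpos := homogeneous_of_le p Hle).
  (* [p zero] is fixed by doubling. *)
  assert (Hzero : p zero = 0).
  { assert (H := Hpos 2 zero ltac:(lra)).
    rewrite scal_zero_r in H; lra. }
  assert (Hsub : sublinear p).
  { split.
    - intros x y.
      assert (H : p (plus x y) - p y <= p x); [|lra].
      apply (Hp x); intros c Hc.
      assert (H : p (plus x y) - c <= p y); [|lra].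
      apply (Hp y); intros d Hd.
      assert (H := proj1 (Hp (plus x y)) _ (Hadd _ _ _ _ Hc Hd)); lra.
    - intros t x [Ht| <-]; [auto|].
      rewrite scal_R0, Hzero; ring. }
  destruct (hHB V p (fun x => x = zero) (fun _ => 0) Hsub) as [g [Hg [_ Hgp]]].
  - split; [reflexivity|split].
    + intros x y -> ->; apply plus_zero_l.
    + intros t x ->; apply scal_zero_r.
  - split; intros; ring.
  - intros x ->; lra.
  - exists g; split; [exact Hg|].
    intros x c Hc; apply Rle_trans with (p x); [apply Hgp|].
    now apply Hp.
Qed.

Lemma linear_plus_eq {V : ModuleSpace R_Ring} (f : V -> R) (x y : V) :
  linear f -> f (plus x y) = f x + f y.
Proof. intros [H _]; now apply H. Qed.

Lemma linear_scal_eq {V : ModuleSpace R_Ring} (f : V -> R) (t : R) (x : V) :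
  linear f -> f (scal t x) = t * f x.
Proof. intros [_ H]; now apply H. Qed.

Lemma linear_opp_eq {V : ModuleSpace R_Ring} (f : V -> R) (x : V) :
  linear f -> f (opp x) = - f x.
Proof.
  intro H; rewrite <- scal_opp_one, (linear_scal_eq f _ _ H).
  change (opp one : R) with (- 1); ring.
Qed.

Definition seminorm {V : ModuleSpace R_Ring} (N : V -> R) : Prop :=
  sublinear N /\ forall x, N (opp x) = N x.

Lemma seminorm_zero {V : ModuleSpace R_Ring} (N : V -> R) :
  seminorm N -> N zero = 0.
Proof.
  intros [[_ H] _].
  assert (H0 := H 0 zero (Rle_refl 0)).
  rewrite scal_R0 in H0; lra.
Qed.

Lemma seminorm_ge_0 {V : ModuleSpace R_Ring} (N : V -> R) (x : V) :
  seminorm N -> 0 <= N x.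
Proof.
  intro HN; assert (H0 := seminorm_zero N HN).
  destruct HN as [[H _] Hopp].
  assert (H1 := H x (opp x)).
  rewrite vplus_opp_r, Hopp in H1; lra.
Qed.

Definition dual_ball {V : ModuleSpace R_Ring} (N : V -> R) (f : V -> R) : Prop :=
  linear f /\ forall x, f x <= N x.

Lemma dual_ball_abs {V : ModuleSpace R_Ring} (N f : V -> R) (x : V) :
  seminorm N -> dual_ball N f -> Rabs (f x) <= N x.
Proof.
  intros [_ HN] [Hf Hn]; apply Rabs_le; split; [|apply Hn].
  assert (H := Hn (opp x)).
  rewrite HN, (linear_opp_eq f x Hf) in H; lra.
Qed.

(** The cone consists of the pairs (x, c) with ||x + t k + y|| <= c + t theta for
    some t >= 0, k in K, y in Y. It is bounded below since [Y] is at distance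
    [theta] from [K]. It contains (x, N x), (y, 0) for y in Y, and
    (- k, - theta), which are the three properties of the functional. *)
Lemma separating_functional (hHB : HB) (V : ModuleSpace R_Ring)
    (N : V -> R) (Y K : V -> Prop) (theta : R) :
  seminorm N ->
  subspace Y -> convex K -> (exists k, K k) -> 0 <= theta ->
  (forall y k, Y y -> K k -> theta <= N (minus y k)) ->
  exists f : V -> R, dual_ball N f /\ (forall y, Y y -> f y = 0) /\
    forall k, K k -> theta <= f k.
Proof.
  intros HN [Y0 [Yadd Yscal]] HK [k0 Kk0] Htheta Hd.
  assert (Nzero := seminorm_zero N HN).
  assert (Npos := fun x => seminorm_ge_0 N x HN).
  destruct HN as [[Ntri Nscal] Nopp].
  assert (Yopp : forall y, Y y -> Y (opp y)).
  { intros y Hy; rewrite <- scal_opp_one; now apply Yscal. }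
  set (U := fun (x : V) (c : R) => exists t k y, 0 <= t /\ K k /\ Y y /\
    N (plus x (plus (scal t k) y)) <= c + t * theta).
  assert (Hfar : forall t k y, 0 <= t -> K k -> Y y ->
    t * theta <= N (plus (scal t k) y)).
  { intros t k y [Ht| <-] Hk Hy.
    - assert (Ht' : 0 < / t) by now apply Rinv_0_lt_compat.
      assert (H := Hd (opp (scal (/ t) y)) k (Yopp _ (Yscal _ _ Hy)) Hk).
      assert (Hm : minus (opp (scal (/ t) y)) k = opp (plus (scal (/ t) y) k))
        by (symmetry; exact (opp_plus (scal (/ t) y) k)).
      rewrite Hm, Nopp in H.
      replace (plus (scal (/ t) y) k)
        with (scal (/ t) (plus (scal t k) y)) in H.
      + rewrite Nscal in H by lra.
        apply Rmult_le_reg_l with (/ t); [exact Ht'|].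
        now replace (/ t * (t * theta)) with theta by (field; lra).
      + rewrite scal_distr_l, scal_inv by lra; apply plus_comm.
    - rewrite Rmult_0_l; apply Npos. }
  destruct (hahn_banach_cone hHB V U) as [f [Hf HfU]].
  - intros x x' c c' [t [k [y [Ht [Hk [Hy H]]]]]] [t' [k' [y' [Ht' [Hk' [Hy' H']]]]]].
    (* By convexity t k + t' k' is t + t' times a point of [K]; when both
       weights vanish, any point of [K] serves. *)
    assert (Hk'' : exists k'', K k'' /\
      scal (t + t') k'' = plus (scal t k) (scal t' k')).
    { destruct (Req_dec (t + t') 0) as [Hz|Hz].
      - exists k; split; [exact Hk|].
        assert (t = 0) by lra; assert (t' = 0) by lra; subst.
        replace (0 + 0) with 0 by ring.
        now rewrite !scal_R0, plus_zero_l.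
      - exists (plus (scal (t / (t + t')) k) (scal (1 - t / (t + t')) k')).
        split.
        + apply HK; auto; split.
          * apply Rmult_le_pos; [lra|].
            apply Rlt_le, Rinv_0_lt_compat; lra.
          * apply Rmult_le_reg_r with (t + t'); [lra|].
            field_simplify; lra.
        + rewrite scal_distr_l, !scal_assoc.
          f_equal; f_equal; unfold mult; simpl; field; lra. }
    destruct Hk'' as [k'' [Kk'' Ek'']].
    exists (t + t'), k'', (plus y y').
    split; [lra|]; split; [exact Kk''|]; split; [now apply Yadd|].
    rewrite Ek''.
    replace (plus (plus x x') (plus (plus (scal t k) (scal t' k')) (plus y y')))
      with (plus (plus x (plus (scal t k) y)) (plus x' (plus (scal t' k') y'))).
    + eapply Rle_trans; [apply Ntri|]. lra.
    + assert (swap : forall a1 a2 b1 b2 : V,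
        plus (plus a1 a2) (plus b1 b2) = plus (plus a1 b1) (plus a2 b2)).
      { intros a1 a2 b1 b2; rewrite <- !plus_assoc; f_equal.
        rewrite !plus_assoc; f_equal; apply plus_comm. }
      rewrite (swap (scal t k)), (swap x x'); reflexivity.
  - intros l x c Hl [t [k [y [Ht [Hk [Hy H]]]]]].
    exists (l * t), k, (scal l y).
    split; [apply Rmult_le_pos; lra|]; split; [exact Hk|].
    split; [now apply Yscal|].
    replace (plus (scal l x) (plus (scal (l * t) k) (scal l y)))
      with (scal l (plus x (plus (scal t k) y))).
    + rewrite Nscal by lra.
      replace (l * c + l * t * theta) with (l * (c + t * theta)) by ring.
      apply Rmult_le_compat_l; [lra|exact H].
    + now rewrite !scal_distr_l, scal_assoc.
  - intro x; exists (N x), 0, k0, zero.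
    split; [lra|]; split; [exact Kk0|]; split; [exact Y0|].
    rewrite scal_R0, !plus_zero_r; lra.
  - intro x; exists (- N x); intros c [t [k [y [Ht [Hk [Hy H]]]]]].
    assert (H1 := Hfar t k y Ht Hk Hy).
    assert (H2 := Ntri (opp x) (plus x (plus (scal t k) y))).
    rewrite (plus_assoc (opp x : V)), vplus_opp_l, plus_zero_l, Nopp in H2.
    lra.
  - assert (HfY : forall y, Y y -> f y <= 0).
    { intros y Hy; apply HfU.
      exists 0, k0, (opp y); split; [lra|]; split; [exact Kk0|].
      split; [now apply Yopp|].
      rewrite scal_R0, plus_zero_l, vplus_opp_r, Nzero; lra. }
    exists f; split; [split; [exact Hf|]|split].
    + intro x; apply HfU.
      exists 0, k0, zero.
      split; [lra|]; split; [exact Kk0|]; split; [exact Y0|].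
      rewrite scal_R0, !plus_zero_r; lra.
    + intros y Hy; apply Rle_antisym; [auto|].
      assert (H := HfY _ (Yopp _ Hy)).
      rewrite (linear_opp_eq f y Hf) in H; lra.
    + intros k Hk.
      assert (H : f (opp k) <= - theta).
      { apply HfU; exists 1, k, zero.
        split; [lra|]; split; [exact Hk|]; split; [exact Y0|].
        rewrite scal_R1, plus_zero_r, vplus_opp_l, Nzero; lra. }
      rewrite (linear_opp_eq f k Hf) in H; lra.
Qed.

(** * Convex blocks and cluster functionals *)

Inductive tail_hull {V : Type} (F : nat -> V -> R) (n : nat) : (V -> R) -> Prop :=
| tail_hull_term k : (n <= k)%nat -> tail_hull F n (F k)
| tail_hull_mix f g t : 0 <= t <= 1 -> tail_hull F n f -> tail_hull F n g ->
    tail_hull F n (fun x => t * f x + (1 - t) * g x).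

(** Reflexive and transitive; subsequences are a special case. The bound on the
    indices holds for every [n], not only eventually, so that a diagonal sequence
    is from rank [n] on a block sequence of the [n]-th one. *)
Definition block_of {V : Type} (F' F : nat -> V -> R) : Prop :=
  forall n, tail_hull F n (F' n).

Lemma tail_hull_le {V : Type} (F : nat -> V -> R) (m n : nat) (f : V -> R) :
  (m <= n)%nat -> tail_hull F n f -> tail_hull F m f.
Proof.
  intros Hmn H; induction H as [k Hk|f g t Ht _ IHf _ IHg].
  - apply tail_hull_term; lia.
  - now apply tail_hull_mix.
Qed.

Lemma tail_hull_block {V : Type} (F' F : nat -> V -> R) (n : nat) (f : V -> R) :
  block_of F' F -> tail_hull F' n f -> tail_hull F n f.
Proof.
  intros HB H; induction H as [k Hk|f g t Ht _ IHf _ IHg].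
  - now apply tail_hull_le with k.
  - now apply tail_hull_mix.
Qed.

Lemma block_of_refl {V : Type} (F : nat -> V -> R) : block_of F F.
Proof. intro n; now apply tail_hull_term. Qed.

Lemma block_of_trans {V : Type} (F'' F' F : nat -> V -> R) :
  block_of F'' F' -> block_of F' F -> block_of F'' F.
Proof. intros H2 H1 n; apply (tail_hull_block F'); auto. Qed.

Lemma tail_hull_ge {V : Type} (F : nat -> V -> R) (n : nat) (f : V -> R)
    (x : V) (c : R) :
  (forall k, (n <= k)%nat -> c <= F k x) -> tail_hull F n f -> c <= f x.
Proof.
  intros Hc H; induction H as [k Hk|f g t Ht _ IHf _ IHg]; [auto|].
  nra.
Qed.

Lemma tail_hull_dual_ball {V : ModuleSpace R_Ring} (N : V -> R)
    (F : nat -> V -> R) (n : nat) (f : V -> R) :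
  (forall k, dual_ball N (F k)) -> tail_hull F n f -> dual_ball N f.
Proof.
  intros HF H; induction H as [k Hk|f g t Ht _ [Hf Nf] _ [Hg Ng]]; [auto|].
  split; [split|].
  - intros x y _ _.
    rewrite (linear_plus_eq f x y Hf), (linear_plus_eq g x y Hg); ring.
  - intros l x _.
    rewrite (linear_scal_eq f l x Hf), (linear_scal_eq g l x Hg); ring.
  - intro x; specialize (Nf x); specialize (Ng x); nra.
Qed.

(** Only the lower bound liminf F_n(x) <= w(x) is required: the upper bound
    w(x) <= limsup F_n(x) is the same condition at - x. *)
Definition cluster {V : ModuleSpace R_Ring} (F : nat -> V -> R) (w : V -> R) : Prop :=
  linear w /\
  forall x c m, (forall n, (m <= n)%nat -> c <= F n x) -> c <= w x.

(** A half-space that contains a tail of [F] contains the convex blocks of that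
    tail. *)
Lemma cluster_block {V : ModuleSpace R_Ring} (F' F : nat -> V -> R) (w : V -> R) :
  block_of F' F -> cluster F' w -> cluster F w.
Proof.
  intros HB [Hw Hc]; split; [exact Hw|].
  intros x c m Hm; apply (Hc x c m); intros n Hn.
  apply (tail_hull_ge F n); [|apply HB].
  intros k Hk; apply Hm; lia.
Qed.

Lemma cluster_le {V : ModuleSpace R_Ring} (N : V -> R) (F : nat -> V -> R)
    (w : V -> R) (x : V) (c : R) (m : nat) :
  (forall k, dual_ball N (F k)) -> cluster F w ->
  (forall n, (m <= n)%nat -> F n x <= c) -> w x <= c.
Proof.
  intros HF [Hw Hc] Hm.
  assert (H : - c <= w (opp x)).
  { apply (Hc _ _ m); intros n Hn.
    rewrite (linear_opp_eq _ x (proj1 (HF n))).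
    specialize (Hm n Hn); lra. }
  rewrite (linear_opp_eq w x Hw) in H; lra.
Qed.

Lemma cluster_dual_ball {V : ModuleSpace R_Ring} (N : V -> R)
    (F : nat -> V -> R) (w : V -> R) :
  (forall k, dual_ball N (F k)) -> cluster F w -> dual_ball N w.
Proof.
  intros HF Hw; split; [apply Hw|].
  intro x; apply (cluster_le N F w x (N x) 0 HF Hw).
  intros n _; apply HF.
Qed.

(** The linear functionals dominated by the sublinear function limsup F_n. *)
Lemma cluster_exists (hHB : HB) {V : ModuleSpace R_Ring} (N : V -> R)
    (F : nat -> V -> R) :
  seminorm N -> (forall k, dual_ball N (F k)) -> exists w, cluster F w.
Proof.
  intros HN HF.
  set (U := fun x c => exists m, forall n, (m <= n)%nat -> F n x <= c).
  destruct (hahn_banach_cone hHB V U) as [w [Hw HU]].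
  - intros x y c d [m Hm] [m' Hm']; exists (max m m'); intros n Hn.
    rewrite (linear_plus_eq _ x y (proj1 (HF n))).
    specialize (Hm n ltac:(lia)); specialize (Hm' n ltac:(lia)); lra.
  - intros t x c Ht [m Hm]; exists m; intros n Hn.
    rewrite (linear_scal_eq _ t x (proj1 (HF n))).
    apply Rmult_le_compat_l; [lra|auto].
  - intro x; exists (N x), O; intros n _; apply HF.
  - intro x; exists (- N x); intros c [m Hm].
    specialize (Hm m (le_n m)).
    assert (H := dual_ball_abs N (F m) x HN (HF m)).
    apply Rabs_le_between in H; lra.
  - exists w; split; [exact Hw|].
    intros x c m Hm.
    assert (H : w (opp x) <= - c).
    { apply HU; exists m; intros n Hn.
      rewrite (linear_opp_eq _ x (proj1 (HF n))).
      specialize (Hm n Hn); lra. }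
    rewrite (linear_opp_eq w x Hw) in H; lra.
Qed.

(** Since w(x) >= liminf F_n(x), infinitely many of the F_n(x) are below
    w(x) + eps. Along them, every cluster functional has a value at most
    w(x) + eps at x: the supremum of s - w' over the ball, which a well chosen
    x nearly attains, cannot drop by more than eps for another w'. *)
Lemma block_pinning (hDC : DC) {V : ModuleSpace R_Ring} (N : V -> R)
    (F : nat -> V -> R) (w : V -> R) (x : V) (eps : R) :
  (forall k, dual_ball N (F k)) -> cluster F w -> 0 < eps ->
  exists F', block_of F' F /\ forall w', cluster F' w' -> w' x <= w x + eps.
Proof.
  intros HF Hw Heps.
  assert (Hinf : forall m, exists k, (m <= k)%nat /\ F k x <= w x + eps).
  { intro m; apply NNPP; intro Hno.
    assert (H : w x + eps <= w x); [|lra].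
    apply (proj2 Hw x _ m); intros n Hn.
    apply Rnot_lt_le; intro Hlt; apply Hno; exists n; split; [exact Hn|lra]. }
  destruct (countable_choice hDC nat _ Hinf) as [k Hk].
  exists (fun n => F (k n)); split.
  - intro n; apply tail_hull_term, Hk.
  - intros w' Hw'.
    apply (cluster_le N (fun n => F (k n)) w' x _ 0); auto.
    intros n _; apply Hk.
Qed.

(** * Choosing nearly optimal blocks *)

(** The levels [c] that the supremum of s + tau g - w over the unit ball and over
    the cluster functionals w of a block sequence F' can be kept under, by
    choosing [g] and [F']. Being upward closed, this set replaces the
    double supremum, and only its infimum is ever taken. *)
Definition attainable {V : ModuleSpace R_Ring} (N : V -> R) (n : nat) (s : V -> R)
    (tau : R) (F : nat -> V -> R) (c : R) : Prop :=
  exists g F', tail_hull F n g /\ block_of F' F /\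
    forall w x, cluster F' w -> N x <= 1 -> s x + tau * g x - w x <= c.

(** After g has been used with weight tau (1 - r), what a later g' achieves with
    the remaining weight tau r is achieved now by r g' + (1 - r) g. Hence the
    infima of the attainable levels increase from stage to stage. *)
Lemma attainable_next {V : ModuleSpace R_Ring} (N : V -> R) (n : nat)
    (s s' g : V -> R) (tau r : R) (F F' : nat -> V -> R) (c : R) :
  0 <= r <= 1 -> tail_hull F n g -> block_of F' F ->
  (forall x, s' x = s x + tau * (1 - r) * g x) ->
  attainable N (S n) s' (tau * r) F' c -> attainable N n s tau F c.
Proof.
  intros Hr Hg HF' Hs' [g' [F'' [Hg' [HF'' Hc]]]].
  exists (fun x => r * g' x + (1 - r) * g x), F''; split; [|split].
  - apply tail_hull_mix; [exact Hr| |exact Hg].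
    apply tail_hull_le with (S n); [lia|].
    now apply tail_hull_block with F'.
  - now apply block_of_trans with F'.
  - intros w x Hw Hx.
    specialize (Hc w x Hw Hx); rewrite Hs' in Hc; lra.
Qed.

(** Take [g] and a block sequence attaining a level below a + eps. As a - eps is
    not attainable, some cluster functional and some point x of the ball give a
    value above a - eps; pinning the sequence at x makes this hold, up to
    another eps, for all the cluster functionals that are left. *)
Lemma optimal_block (hHB : HB) (hDC : DC) {V : ModuleSpace R_Ring} (N : V -> R)
    (n : nat) (s : V -> R) (tau : R) (F : nat -> V -> R) (b M eps : R) :
  seminorm N -> (forall k, dual_ball N (F k)) -> 0 <= tau -> 0 < eps ->
  (forall x, N x <= 1 -> s x <= M) ->
  (forall c, attainable N n s tau F c -> b <= c) ->
  exists a g F',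
    (forall c, attainable N n s tau F c -> a <= c) /\ b <= a /\
    tail_hull F n g /\ block_of F' F /\
    (forall w x, cluster F' w -> N x <= 1 -> s x + tau * g x - w x <= a + eps) /\
    (forall w, cluster F' w -> exists x, N x <= 1 /\
       a - 2 * eps <= s x + tau * g x - w x).
Proof.
  intros HN HF Htau Heps Hs Hb.
  destruct (Glb_Rbar_finite (attainable N n s tau F) b) as [Hlow Hgr].
  - exists (M + tau + 1), (F n), F.
    split; [now apply tail_hull_term|]; split; [apply block_of_refl|].
    intros w x Hw Hx.
    assert (H1 := Hs x Hx).
    assert (H2 := proj2 (HF n) x).
    assert (H3 := dual_ball_abs N w x HN (cluster_dual_ball N F w HF Hw)).
    apply Rabs_le_between in H3.
    assert (tau * F n x <= tau * 1) by (apply Rmult_le_compat_l; lra).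
    lra.
  - exact Hb.
  - set (a := real (Glb_Rbar (attainable N n s tau F))) in *.
    assert (Happ : exists c, attainable N n s tau F c /\ c < a + eps).
    { apply NNPP; intro Hno.
      assert (H : a + eps <= a); [|lra].
      apply Hgr; intros c Hc.
      apply Rnot_lt_le; intro Hlt; apply Hno; now exists c. }
    destruct Happ as [c [[g [F' [Hg [HF' Hc]]]] Hca]].
    assert (HF'b : forall k, dual_ball N (F' k)).
    { intro k; apply (tail_hull_dual_ball N F k); auto. }
    assert (Hbig : exists w x, cluster F' w /\ N x <= 1 /\
              a - eps < s x + tau * g x - w x).
    { apply NNPP; intro Hno.
      assert (H : a <= a - eps); [|lra].
      apply Hlow; exists g, F'; split; [exact Hg|]; split; [exact HF'|].
      intros w x Hw Hx; apply Rnot_lt_le; intro Hlt.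
      apply Hno; now exists w, x. }
    destruct Hbig as [w0 [x0 [Hw0 [Hx0 Hgap]]]].
    destruct (block_pinning hDC N F' w0 x0 eps HF'b Hw0 Heps) as [F'' [HF'' Hpin]].
    exists a, g, F''.
    split; [exact Hlow|]; split; [now apply Hgr|]; split; [exact Hg|].
    split; [now apply block_of_trans with F'|]; split.
    + intros w x Hw Hx.
      assert (H := Hc w x (cluster_block F'' F' w HF'' Hw) Hx); lra.
    + intros w Hw; exists x0; split; [exact Hx0|].
      specialize (Hpin w Hw); lra.
Qed.

(** One step of the recursion. [block] and [level] are what was chosen to pass
    from the previous stage to this one. *)
Record stage (V : Type) := Stage
  { index : nat; partial : V -> R; family : nat -> V -> R;
    block : V -> R; level : R }.
Arguments Stage {V}.
Arguments index {V}.
Arguments partial {V}.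
Arguments family {V}.
Arguments block {V}.
Arguments level {V}.

(** The errors eps_n, divided by r^(n+1), sum to theta/2. Dividing the recursion
    for the partial sums at y by the weight left, r^n, turns the accumulated error
    into this sum, which has to stay below the gap theta. *)
Definition tolerance (r theta : R) (n : nat) : R :=
  r ^ S n * (theta / 4) * (1 / 2) ^ n.

Lemma tolerance_pos (r theta : R) (n : nat) :
  0 < r -> 0 < theta -> 0 < tolerance r theta n.
Proof.
  intros Hr Ht; unfold tolerance.
  apply Rmult_lt_0_compat; [apply Rmult_lt_0_compat|].
  - now apply pow_lt.
  - lra.
  - apply pow_lt; lra.
Qed.

Lemma near_optimal_blocks (hHB : HB) (hDC : DC) {V : ModuleSpace R_Ring}
    (N : V -> R) (F0 : nat -> V -> R) (r theta : R) :
  seminorm N -> (forall k, dual_ball N (F0 k)) -> 0 < r < 1 -> 0 < theta ->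
  (forall g w, tail_hull F0 0 g -> cluster F0 w ->
     exists x, N x <= 1 /\ theta <= g x - w x) ->
  exists (s g : nat -> V -> R) (F : nat -> nat -> V -> R) (a : nat -> R),
    (forall x, s O x = 0) /\ F O = F0 /\
    forall n,
      (forall x, s (S n) x = s n x + r ^ n * (1 - r) * g n x) /\
      tail_hull (F n) n (g n) /\ block_of (F (S n)) (F n) /\
      theta <= a n /\ a n <= a (S n) /\
      (forall w x, cluster (F (S n)) w -> N x <= 1 ->
         s n x + r ^ n * g n x - w x <= a n + tolerance r theta n) /\
      (forall w, cluster (F (S n)) w -> exists x, N x <= 1 /\
         a n - 2 * tolerance r theta n <= s n x + r ^ n * g n x - w x).
Proof.
  intros HN HF0 Hr Htheta Hsep.
  (* [level] is kept below all levels attainable at the current stage; this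
     gives the monotonicity, and [theta] as the first lower bound. *)
  set (P := fun p : stage V =>
    (forall k, dual_ball N (family p k)) /\
    (exists M, forall x, N x <= 1 -> partial p x <= M) /\
    theta <= level p /\
    forall c, attainable N (index p) (partial p) (r ^ index p) (family p) c ->
      level p <= c).
  set (T := fun p q : stage V =>
    index q = S (index p) /\
    (forall x, partial q x =
       partial p x + r ^ index p * (1 - r) * block q x) /\
    tail_hull (family p) (index p) (block q) /\
    block_of (family q) (family p) /\
    level p <= level q /\
    (forall w x, cluster (family q) w -> N x <= 1 ->
       partial p x + r ^ index p * block q x - w x
         <= level q + tolerance r theta (index p)) /\
    (forall w, cluster (family q) w -> exists x, N x <= 1 /\
       level q - 2 * tolerance r theta (index p)
         <= partial p x + r ^ index p * block q x - w x)).
  destruct (DC_from hDC (stage V) P T (Stage O (fun _ => 0) F0 (fun _ => 0) theta))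
    as [u [Hu0 Hu]].
  - split; [exact HF0|]; split; [exists 0; simpl; intros; lra|].
    split; [simpl; lra|].
    simpl; intros c [g [F' [Hg [HF' Hc]]]].
    destruct (cluster_exists hHB N F' HN) as [w Hw].
    { intro k; apply (tail_hull_dual_ball N F0 k); auto. }
    destruct (Hsep g w Hg (cluster_block F' F0 w HF' Hw)) as [x [Hx Hgx]].
    specialize (Hc w x Hw Hx); lra.
  - intros p [HF [[M HM] [Hth Hlev]]].
    assert (Hrn : 0 < r ^ index p) by (apply pow_lt; lra).
    destruct (optimal_block hHB hDC N (index p) (partial p) (r ^ index p)
                (family p) (level p) M (tolerance r theta (index p)))
      as [a [g [F' [Hlow [Hla [Hg [HF' [Hup Hdown]]]]]]]]; auto.
    + lra.
    + apply tolerance_pos; lra.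
    + exists (Stage (S (index p))
               (fun x => partial p x + r ^ index p * (1 - r) * g x) F' g a).
      split; [|repeat split; auto].
      split; [|split; [|split]]; simpl.
      * intro k; apply (tail_hull_dual_ball N (family p) k); auto.
      * exists (M + r ^ index p * (1 - r)); intros x Hx.
        specialize (HM x Hx).
        assert (Hgx : g x <= 1).
        { apply Rle_trans with (N x); [|exact Hx].
          apply (tail_hull_dual_ball N (family p) (index p) g HF Hg). }
        assert (0 <= r ^ index p * (1 - r)) by (apply Rmult_le_pos; lra).
        nra.
      * lra.
      * intros c Hc; apply Hlow.
        apply (attainable_next N (index p) (partial p)
          (fun x => partial p x + r ^ index p * (1 - r) * g x) g
          (r ^ index p) r (family p) F'); auto.
        -- lra.
        -- now rewrite (Rmult_comm (r ^ index p) r).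
  - assert (Hidx : forall n, index (u n) = n).
    { induction n as [|n IH]; [now rewrite Hu0|].
      now rewrite (proj1 (proj2 (Hu n))), IH. }
    exists (fun n => partial (u n)), (fun n => block (u (S n))),
      (fun n => family (u n)), (fun n => level (u (S n))).
    split; [now rewrite Hu0|]; split; [now rewrite Hu0|].
    intro n.
    destruct (Hu n) as [_ HT]; unfold T in HT; rewrite (Hidx n) in HT.
    destruct HT as [_ [H1 [H2 [H3 [H4 [H5 H6]]]]]].
    split; [exact H1|]; split; [exact H2|]; split; [exact H3|].
    split; [apply (proj1 (Hu (S n)))|]; split; [|split; [exact H5|exact H6]].
    apply (proj2 (Hu (S n))).
Qed.

(** * Passing to the limit *)

(** The weights r^k (1 - r) with k >= n add up to r^n, which gives both
    the Cauchy property and the distance to the sum. *)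
Lemma geometric_combination {V : ModuleSpace R_Ring} (N : V -> R)
    (s g : nat -> V -> R) (r : R) :
  seminorm N -> 0 < r < 1 -> (forall n, dual_ball N (g n)) ->
  (forall x, s O x = 0) ->
  (forall n x, s (S n) x = s n x + r ^ n * (1 - r) * g n x) ->
  exists h, linear h /\ forall n x, Rabs (h x - s n x) <= r ^ n * N x.
Proof.
  intros HN Hr Hg Hs0 HsS.
  assert (Hlin : forall n, linear (s n)).
  { induction n as [|n IH]; split.
    - intros x y _ _; rewrite !Hs0; ring.
    - intros t x _; rewrite !Hs0; ring.
    - intros x y _ _; rewrite !HsS, (linear_plus_eq _ x y IH),
        (linear_plus_eq _ x y (proj1 (Hg n))); ring.
    - intros t x _; rewrite !HsS, (linear_scal_eq _ t x IH),
        (linear_scal_eq _ t x (proj1 (Hg n))); ring. }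
  assert (Hrn : forall n, 0 < r ^ n) by (intro n; apply pow_lt; lra).
  assert (Hdiff : forall n d x,
    Rabs (s (n + d)%nat x - s n x) <= (r ^ n - r ^ (n + d)) * N x).
  { intros n d x; induction d as [|d IH].
    - rewrite Nat.add_0_r, !Rminus_diag, Rabs_R0; lra.
    - rewrite Nat.add_succ_r, HsS.
      assert (H := dual_ball_abs N (g (n + d)%nat) x HN (Hg _)).
      assert (Hb : 0 <= r ^ (n + d) * (1 - r))
        by (apply Rmult_le_pos; [apply Rlt_le, Hrn|lra]).
      apply Rabs_le_between in IH; apply Rabs_le_between in H.
      simpl; apply Rabs_le; nra. }
  assert (Hdist : forall n m x, (n <= m)%nat -> Rabs (s m x - s n x) <= r ^ n * N x).
  { intros n m x Hnm; replace m with (n + (m - n))%nat by lia.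
    eapply Rle_trans; [apply Hdiff|].
    apply Rmult_le_compat_r; [now apply seminorm_ge_0|].
    specialize (Hrn (n + (m - n))%nat); lra. }
  assert (Hex : forall x, ex_finite_lim_seq (fun n => s n x)).
  { intro x; apply ex_lim_seq_cauchy_corr; intro eps.
    assert (HNx := seminorm_ge_0 N x HN).
    assert (He : 0 < eps / (2 * (N x + 1))).
    { apply Rdiv_lt_0_compat; [apply cond_pos|lra]. }
    destruct (pow_lt_1_zero r ltac:(rewrite Rabs_pos_eq; lra) _ He) as [m Hm].
    specialize (Hm m (le_n m)).
    rewrite Rabs_pos_eq in Hm by apply Rlt_le, Hrn.
    exists m; intros i j Hi Hj.
    assert (Hi' := Hdist m i x Hi); assert (Hj' := Hdist m j x Hj).
    assert (Hlt : r ^ m * N x < eps / 2).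
    { apply Rle_lt_trans with (r ^ m * (N x + 1)).
      - apply Rmult_le_compat_l; [apply Rlt_le, Hrn|lra].
      - apply Rmult_lt_reg_r with (/ (N x + 1)).
        + apply Rinv_0_lt_compat; lra.
        + replace (r ^ m * (N x + 1) * / (N x + 1)) with (r ^ m) by (field; lra).
          replace (eps / 2 * / (N x + 1)) with (eps / (2 * (N x + 1)))
            by (field; lra).
          exact Hm. }
    apply Rabs_le_between in Hi'; apply Rabs_le_between in Hj'.
    apply Rabs_lt_between; lra. }
  exists (fun x => real (Lim_seq (fun n => s n x))).
  assert (Hlim : forall x,
    is_lim_seq (fun n => s n x) (real (Lim_seq (fun n => s n x)))).
  { intro x; apply Lim_seq_correct', Hex. }
  assert (Huniq : forall (v : nat -> R) (l l' : R),
    is_lim_seq v l -> is_lim_seq v l' -> l = l').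
  { intros v l l' H H'.
    apply is_lim_seq_unique in H; apply is_lim_seq_unique in H'.
    rewrite H in H'; now injection H'. }
  split; [split|].
  - intros x y _ _; apply (Huniq (fun n => s n (plus x y))); [apply Hlim|].
    apply is_lim_seq_ext with (fun n => s n x + s n y).
    + intro n; symmetry; apply linear_plus_eq, Hlin.
    + apply is_lim_seq_plus'; apply Hlim.
  - intros t x _; apply (Huniq (fun n => s n (scal t x))); [apply Hlim|].
    apply is_lim_seq_ext with (fun n => t * s n x).
    + intro n; symmetry; apply linear_scal_eq, Hlin.
    + exact (is_lim_seq_scal_l _ t _ (Hlim x)).
  - intros n x.
    assert (Hle : is_lim_seq (fun m => s (m + n)%nat x - s n x)
              (real (Lim_seq (fun m => s m x)) - s n x)).
    { apply is_lim_seq_minus'; [|apply is_lim_seq_const].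
      apply (is_lim_seq_incr_n (fun m => s m x)), Hlim. }
    assert (Hd : forall m, - (r ^ n * N x) <= s (m + n)%nat x - s n x <= r ^ n * N x).
    { intro m; apply Rabs_le_between, Hdist; lia. }
    apply Rabs_le; split.
    + exact (is_lim_seq_le _ _ (Finite _) (Finite _) (fun m => proj1 (Hd m))
               (is_lim_seq_const _) Hle).
    + exact (is_lim_seq_le _ _ (Finite _) (Finite _) (fun m => proj2 (Hd m))
               Hle (is_lim_seq_const _)).
Qed.

Lemma tail_hull_iterated {V : Type} (F : nat -> nat -> V -> R) (n d k : nat) f :
  (forall m, block_of (F (S m)) (F m)) ->
  tail_hull (F (n + d)%nat) k f -> tail_hull (F n) k f.
Proof.
  intros HF; induction d as [|d IH].
  - now rewrite Nat.add_0_r.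
  - rewrite Nat.add_succ_r; intro H; apply IH.
    now apply tail_hull_block with (F (S (n + d))).
Qed.

Lemma cluster_diagonal {V : ModuleSpace R_Ring} (F : nat -> nat -> V -> R)
    (g : nat -> V -> R) (w : V -> R) (n : nat) :
  (forall m, block_of (F (S m)) (F m)) -> (forall m, tail_hull (F m) m (g m)) ->
  cluster g w -> cluster (F n) w.
Proof.
  intros HF Hg [Hw Hc]; split; [exact Hw|].
  intros x c m Hm; apply (Hc x c (max n m)); intros k Hk.
  apply (tail_hull_ge (F n) k).
  - intros j Hj; apply Hm; lia.
  - apply (tail_hull_iterated F n (k - n) k); [exact HF|].
    replace (n + (k - n))%nat with k by lia; apply Hg.
Qed.

(** * A functional without a maximum on the unit ball *)

(** The ratio [r] is theta/8, so that the weight r^(n+1) left after the n-th term is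
    small against theta r^n, the size of the gap to be contradicted. *)
Lemma not_attaining (hHB : HB) (hDC : DC) {V : ModuleSpace R_Ring}
    (N : V -> R) (F0 : nat -> V -> R) (theta : R) :
  seminorm N -> (forall k, dual_ball N (F0 k)) -> 0 < theta ->
  (forall g w, tail_hull F0 0 g -> cluster F0 w ->
     exists x, N x <= 1 /\ theta <= g x - w x) ->
  exists v, linear v /\ (forall x, Rabs (v x) <= 2 * N x) /\
    forall y, N y <= 1 -> exists x, N x <= 1 /\ v y < v x.
Proof.
  intros HN HF0 Htheta Hsep.
  assert (Htheta2 : theta <= 2).
  { destruct (cluster_exists hHB N F0 HN HF0) as [w Hw].
    destruct (Hsep (F0 O) w (tail_hull_term F0 0 0 (le_n 0)) Hw) as [x [Hx H]].
    assert (H1 := dual_ball_abs N _ x HN (HF0 O)).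
    assert (H2 := dual_ball_abs N w x HN (cluster_dual_ball N F0 w HF0 Hw)).
    apply Rabs_le_between in H1; apply Rabs_le_between in H2; lra. }
  destruct (ex_intro (fun r => r = theta / 8) _ eq_refl) as [r Hrdef].
  assert (Hr : 0 < r < 1) by lra.
  destruct (near_optimal_blocks hHB hDC N F0 r theta HN HF0 Hr Htheta Hsep)
    as [s [g [F [a [Hs0 [HF00 Hstep]]]]]].
  assert (HsS := fun n => proj1 (Hstep n)).
  assert (Hg := fun n => proj1 (proj2 (Hstep n))).
  assert (HF := fun n => proj1 (proj2 (proj2 (Hstep n)))).
  assert (Hdual : forall n, dual_ball N (g n)).
  { intro n; apply (tail_hull_dual_ball N (F O) n); [now rewrite HF00|].
    now apply (tail_hull_iterated F 0 n). }
  destruct (geometric_combination N s g r HN Hr Hdual Hs0 HsS) as [h [Hh Hhs]].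
  destruct (cluster_exists hHB N g HN Hdual) as [w Hw].
  assert (HwN := cluster_dual_ball N g w Hdual Hw).
  assert (HwF : forall n, cluster (F n) w).
  { intro n; now apply cluster_diagonal with g. }
  exists (fun x => h x - w x); split; [|split].
  - split.
    + intros x y _ _; rewrite (linear_plus_eq h x y Hh),
        (linear_plus_eq w x y (proj1 HwN)); ring.
    + intros t x _; rewrite (linear_scal_eq h t x Hh),
        (linear_scal_eq w t x (proj1 HwN)); ring.
  - intro x; assert (H1 := Hhs O x); assert (H2 := dual_ball_abs N w x HN HwN).
    rewrite Hs0 in H1; simpl in H1.
    apply Rabs_le_between in H1; apply Rabs_le_between in H2.
    apply Rabs_le; lra.
  - intros y Hy; apply NNPP; intro Hno.
    assert (Hmax : forall x, N x <= 1 -> h x - w x <= h y - w y).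
    { intros x Hx; apply Rnot_lt_le; intro Hlt; apply Hno; now exists x. }
    clear Hno; set (A := h y - w y) in *.
    assert (Hrn : forall n, 0 < r ^ n) by (intro n; apply pow_lt; lra).
    assert (Htol : forall n, tolerance r theta n <= r ^ n).
    { intro n; unfold tolerance.
      assert (H : 0 < (1 / 2) ^ n <= 1).
      { split; [apply pow_lt; lra|].
        assert (Hp := pow_incr (1 / 2) 1 n ltac:(lra)).
        now rewrite pow1 in Hp. }
      specialize (Hrn n); simpl.
      set (t := r ^ n) in *.
      assert (H1 : 0 < r * t) by (apply Rmult_lt_0_compat; lra).
      assert (H2 : r * t <= t) by nra.
      assert (H3 : r * t * (theta / 4) <= r * t) by nra.
      assert (H4 : 0 < r * t * (theta / 4)) by (apply Rmult_lt_0_compat; lra).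
      nra. }
    assert (Hmono : forall n d, a n <= a (n + d)%nat).
    { intros n d; induction d as [|d IH].
      - rewrite Nat.add_0_r; lra.
      - rewrite Nat.add_succ_r; apply Rle_trans with (1 := IH).
        apply (Hstep (n + d)%nat). }
    (* For k >= n, v is within 2 r^k of s_k + r^k g_k - w on the ball, whose
       supremum is at least a_n up to an error of order r^k. *)
    assert (HaA : forall n, a n <= A).
    { intro n; apply Rnot_lt_le; intro Hlt.
      destruct (pow_lt_1_zero r ltac:(rewrite Rabs_pos_eq; lra)
                  ((a n - A) / 4) ltac:(lra)) as [m Hm].
      specialize (Hm (n + m)%nat ltac:(lia)).
      rewrite Rabs_pos_eq in Hm by apply Rlt_le, Hrn.
      set (k := (n + m)%nat) in *.
      destruct (Hstep k) as [_ [_ [_ [_ [_ [_ Hdown]]]]]].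
      destruct (Hdown w (HwF (S k))) as [x [Hx Hgap]].
      assert (H1 := Hmax x Hx); assert (H2 := Hhs k x).
      assert (H3 := proj2 (Hdual k) x); assert (H4 := Htol k).
      assert (H5 : a n <= a k) by apply Hmono.
      specialize (Hrn k).
      apply Rabs_le_between in H2.
      assert (r ^ k * N x <= r ^ k * 1) by (apply Rmult_le_compat_l; lra).
      assert (r ^ k * g k x <= r ^ k * 1) by (apply Rmult_le_compat_l; lra).
      lra. }
    (* The value of s_n - (1 - r^n) w at y, the contribution of the first n
       terms to A; the n-th error enters it with weight 1 - r. *)
    assert (Hpartial : forall n, s n y - (1 - r ^ n) * w y <=
              (1 - r ^ n) * A + r ^ n * (theta / 2) * (1 - (1 / 2) ^ n)).
    { induction n as [|n IH]; [rewrite Hs0; simpl; lra|].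
      destruct (Hstep n) as [_ [_ [_ [_ [_ [Hup _]]]]]].
      assert (H1 := Hup w y (HwF (S n)) Hy).
      assert (H2 := HaA n).
      assert (H3 := tolerance_pos r theta n (proj1 Hr) Htheta).
      rewrite HsS; unfold tolerance in *; simpl in *.
      set (t := r ^ n) in *; set (q := (1 / 2) ^ n) in *.
      assert (H4 : (1 - r) * (s n y + t * g n y - w y) <=
                   (1 - r) * (A + r * t * (theta / 4) * q))
        by (apply Rmult_le_compat_l; lra).
      apply Rmult_le_compat_l with (r := r) in IH; [|lra].
      assert (H5 : 0 <= r * (r * t * (theta / 4) * q))
        by (apply Rmult_le_pos; lra).
      lra. }
    assert (Hclose : exists n, g n y < w y + theta / 8).
    { apply NNPP; intro Hno.
      assert (H : w y + theta / 8 <= w y); [|lra].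
      apply (proj2 Hw y _ O); intros n _.
      apply Rnot_lt_le; intro Hlt; apply Hno; now exists n. }
    destruct Hclose as [n Hn].
    assert (H1 := Hpartial n); assert (H2 := Hhs (S n) y).
    assert (H3 := dual_ball_abs N w y HN HwN).
    assert (H4 : theta <= A).
    { apply Rle_trans with (a O); [apply (Hstep O)|apply HaA]. }
    rewrite HsS in H2; simpl in H2.
    apply Rabs_le_between in H2; apply Rabs_le_between in H3.
    specialize (Hrn n); set (t := r ^ n) in *.
    assert (H5 : 0 < (1 / 2) ^ n) by (apply pow_lt; lra).
    assert (H6 : 0 < t * (theta / 2) * (1 / 2) ^ n)
      by (apply Rmult_lt_0_compat; [apply Rmult_lt_0_compat|]; lra).
    assert (H7 : t * (1 - r) * (g n y - w y) <= t * (theta / 8)).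
    { apply Rle_trans with (t * (1 - r) * (theta / 8)).
      - apply Rmult_le_compat_l; [apply Rmult_le_pos|]; lra.
      - assert (0 < t * r * (theta / 8)) by
          (apply Rmult_lt_0_compat; [apply Rmult_lt_0_compat|]; lra).
        lra. }
    assert (H8 : r * t * (N y - w y) <= r * t * 2).
    { apply Rmult_le_compat_l; [apply Rmult_le_pos|]; lra. }
    (* The first n terms give at most (1 - t) A + t theta/2, the n-th one at
       most t theta/8, and the others at most 2 r t. *)
    assert (H9 : t * A <= t * (theta / 2 + theta / 8 + 2 * r)).
    { unfold A in *; lra. }
    apply Rmult_le_reg_l in H9; [|exact Hrn].
    lra.
Qed.

(** * The functionals attached to a sequence whose tails stay away from its spans *)

Lemma span_subspace {V : ModuleSpace R_Ring} (A : V -> Prop) : subspace (span A).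
Proof.
  split; [|split].
  - intros F [H _] _; exact H.
  - intros x y Hx Hy F HF HA; apply HF; [now apply Hx|now apply Hy].
  - intros t x Hx F HF HA; apply HF; now apply Hx.
Qed.

Lemma conv_convex {V : ModuleSpace R_Ring} (A : V -> Prop) : convex (conv A).
Proof.
  intros x y t Hx Hy Ht C HC HA; apply HC; [now apply Hx|now apply Hy|exact Ht].
Qed.

Lemma james_functionals (hHB : HB) (hDC : DC) {V : ModuleSpace R_Ring}
    (N : V -> R) (a : nat -> V) (theta : R) :
  seminorm N -> 0 < theta ->
  (forall n y k, span (fun x => exists i, (i < n)%nat /\ x = a i) y ->
     conv (fun x => exists i, (n <= i)%nat /\ x = a i) k ->
     theta <= N (minus y k)) ->
  exists f : nat -> V -> R, (forall n, dual_ball N (f n)) /\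
    (forall n i, (i < n)%nat -> f n (a i) = 0) /\
    (forall n i, (n <= i)%nat -> theta <= f n (a i)).
Proof.
  intros HN Htheta Hd.
  destruct (countable_choice hDC (V -> R) (fun n f => dual_ball N f /\
    (forall i, (i < n)%nat -> f (a i) = 0) /\
    (forall i, (n <= i)%nat -> theta <= f (a i)))) as [f Hf].
  - intro n.
    assert (Hconv : forall i, (n <= i)%nat ->
              conv (fun x => exists j, (n <= j)%nat /\ x = a j) (a i)).
    { intros i Hi C _ HA; apply HA; now exists i. }
    destruct (separating_functional hHB V N
                (span (fun x => exists i, (i < n)%nat /\ x = a i))
                (conv (fun x => exists i, (n <= i)%nat /\ x = a i)) theta HN)
      as [f [Hf [HfY HfK]]].
    + apply span_subspace.
    + apply conv_convex.
    + exists (a n); now apply Hconv.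
    + lra.
    + apply Hd.
    + exists f; split; [exact Hf|]; split.
      * intros i Hi; apply HfY; intros G _ HA; apply HA; now exists i.
      * intros i Hi; now apply HfK, Hconv.
  - exists f; split; [apply Hf|]; split; intros n; apply (Hf n).
Qed.

(** Beyond the indices that occur in [g], every a_i has g(a_i) >= theta, whereas
    w(a_i) is a limit of values f_n(a_i) that are eventually zero. *)
Lemma james_separation {V : ModuleSpace R_Ring} (N : V -> R) (a : nat -> V)
    (f : nat -> V -> R) (theta : R) (g w : V -> R) :
  (forall n, dual_ball N (f n)) ->
  (forall n i, (i < n)%nat -> f n (a i) = 0) ->
  (forall n i, (n <= i)%nat -> theta <= f n (a i)) ->
  tail_hull f 0 g -> cluster f w ->
  exists i, theta <= g (a i) - w (a i).
Proof.
  intros Hf Hzero Hge Hg Hw.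
  assert (Hw0 : forall i, w (a i) <= 0).
  { intro i; apply (cluster_le N f w (a i) 0 (S i) Hf Hw).
    intros n Hn; rewrite Hzero by lia; lra. }
  assert (Hg' : exists m, forall i, (m <= i)%nat -> theta <= g (a i)).
  { induction Hg as [k _|g1 g2 t Ht _ [m1 H1] _ [m2 H2]].
    - exists k; auto.
    - exists (max m1 m2); intros i Hi.
      specialize (H1 i ltac:(lia)); specialize (H2 i ltac:(lia)); nra. }
  destruct Hg' as [m Hm]; exists m.
  specialize (Hm m (le_n m)); specialize (Hw0 m); lra.
Qed.

Lemma Inf_seq_gt_0 (u : nat -> Rbar) :
  Rbar_lt 0 (Inf_seq u) -> exists theta : R, 0 < theta /\
    forall n, Rbar_le theta (u n).
Proof.
  intro H; assert (Hinf := Inf_seq_correct u).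
  destruct (Inf_seq u) as [l| |]; simpl in H, Hinf; [| |contradiction].
  - exists (l / 2); split; [lra|]; intro n.
    destruct (Hinf (mkposreal (l / 2) ltac:(lra))) as [Hn _].
    specialize (Hn n); simpl in Hn.
    apply Rbar_lt_le; now replace (l / 2) with (l - l / 2) by field.
  - exists 1; split; [lra|]; intro n; apply Rbar_lt_le, Hinf.
Qed.

(** * Sup-reflexive spaces are J-reflexive *)

(** The norm of the hierarchy is only given as subhomogeneous. *)
Lemma norm_seminorm (E : NormedModule R_AbsRing) :
  seminorm (V := E) (norm : E -> R).
Proof.
  split; [split|].
  - exact norm_triangle.
  - assert (Hle : forall t (x : E), 0 < t -> norm (scal t x) <= t * norm x).
    { intros t x Ht; assert (H := norm_scal t x).
      change (abs t) with (Rabs t) in H; now rewrite Rabs_pos_eq in H by lra. }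
    intros t x [Ht| <-].
    + now apply (homogeneous_of_le (V := E) norm Hle).
    + rewrite (scal_R0 (V := E)), Rmult_0_l; exact norm_zero.
  - exact norm_opp.
Qed.

Lemma bounded_linear_in_dual {E : NormedModule R_AbsRing} (f : E -> R) (M : R) :
  linear f -> 0 < M -> (forall x : E, Rabs (f x) <= M * norm x) -> in_dual f.
Proof.
  intros Hf HM Hb; split; [exact Hf|intro x].
  apply (@linear_cont R_AbsRing E R_NormedModule f x).
  split.
  - intros y z; exact (linear_plus_eq f y z Hf).
  - intros k y; exact (linear_scal_eq f k y Hf).
  - exists M; split; [exact HM|exact Hb].
Qed.

Theorem corollary1 (hHB : HB) (hDC : DC) (E : NormedModule R_AbsRing) :
  sup_reflexive E -> J_reflexive E.
Proof.
  intros Hsup [a [Ha Hinf]].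
  destruct (Inf_seq_gt_0 _ Hinf) as [theta [Htheta Hdist]].
  assert (HN := norm_seminorm E).
  destruct (james_functionals hHB hDC (V := E) norm a theta HN Htheta)
    as [f [Hf [Hzero Hge]]].
  - intros n y k Hy Hk.
    assert (Hle := Rbar_le_trans _ _ _ (Hdist n) (proj1 (Glb_Rbar_correct _)
      (norm (minus y k)) (ex_intro _ y (ex_intro _ k
        (conj Hy (conj Hk eq_refl)))))).
    exact Hle.
  - destruct (not_attaining hHB hDC (V := E) norm f theta HN Hf Htheta)
      as [v [Hv [Hbound Hno]]].
    + intros g w Hg Hw.
      destruct (james_separation (V := E) norm a f theta g w Hf Hzero Hge Hg Hw)
        as [i Hi].
      exists (a i); split; [apply Ha|exact Hi].
    + destruct (Hsup v (bounded_linear_in_dual v 2 Hv Rlt_0_2 Hbound))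
        as [y [Hy [Hub _]]].
      destruct (Hno y Hy) as [x [Hx Hlt]].
      assert (H := Hub (v x) (ex_intro _ x (conj Hx eq_refl))); lra.
Qed.
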